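(* Let $K$ be a field, and let $f(X,Y)=\sum_{i=0}^{n}a_{i}Y^{i}$, $g(X,Y)=\sum_{i=0}^{n}b_{i}Y^{i}\in K[X,Y]$, with $a_{0},\dots,a_{n},b_{0},\dots,b_{n}\in K[X]$, $a_{0}a_{n}b_{0}b_{n}\neq 0$, and such that $a_j\in K\setminus\{0\}$ and $b_j\in K\setminus\{0\}$ for some index $j\in\{1,\dots,n-1\}$. If $Res_{Y}(f,g)$ is irreducible over $K$ and $$\deg a_{0}>\max\{\deg a_{1},\ldots,\deg a_{n}\},$$ $$\deg b_{n}\geq\max\{\deg b_{0},\ldots,\deg b_{n-1}\},$$ $$\deg a_i\leq\deg b_i\quad\text{for } i=0,\dots,n-1,$$ then $\alpha f+\beta g$ is irreducible in $K[X,Y]$ for any $\alpha,\beta\in K$ with $\alpha a_j+\beta b_j\neq 0$.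
   Context: $Res_Y(f,g)\in K[X]$ is the resultant of $f$ and $g$ regarded as polynomials in $Y$ with coefficients in $K[X]$; $\deg$ is the degree in $X$, with $\deg 0=-\infty$. *)

(* Defs.v *)
From HB Require Import structures.
From mathcomp Require Import all_boot all_order all_algebra.

Set Implicit Arguments.
Unset Strict Implicit.
Unset Printing Implicit Defensive.

Import GRing.Theory.
Local Open Scope ring_scope.

(* MathComp's [irreducible_poly] uses pseudo-division: on {poly {poly K}} it   *)
(* amounts to irreducibility in K(X)[Y] and ignores factors lying in K[X].     *)
(* Irreducibility in K[X,Y] = {poly {poly K}} is therefore stated ring-wise.   *)
Definition irreducible_elt (R : idomainType) (p : R) : Prop :=
  [/\ p != 0, p \isn't a GRing.unit
    & forall q r : R, p = q * r ->
        q \is a GRing.unit \/ r \is a GRing.unit].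

(* Main.v *)
Require Import Defs.
From HB Require Import structures.
From mathcomp Require Import all_boot all_order all_algebra.
From mathcomp Require Import perm.

(** Give K(X) the valuation at infinity, so that the size of a polynomial in X
    measures its absolute value.  The hypothesis on a_0 says that the constant
    coefficient of f strictly dominates the others, hence that all roots of f
    in Y are larger than 1; the hypothesis on b_n says that the leading
    coefficient of g dominates, hence that all roots of g are at most 1.  In
    Newton polygon terms both conditions are about the coefficient of the
    highest power of X, viewed as a polynomial in Y: it is a nonzero constant
    for f, and it has the full Y-degree for g.  As this coefficient is
    multiplicative, both conditions pass to factors (tail_dominated_factor,
    head_dominated_factor).

    If the roots of p are larger than 1 and those of q at most 1, each
    difference of roots in Res(p, q) is as large as the root of p, so no
    cancellation takes place and
      deg Res(p, q) = deg_X p * deg_Y q + deg_X q * deg_Y p.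
    Only the lower bound matters (size_resultant_dominated): a constant
    resultant then forces either argument to be constant in both variables,
    as soon as the other one has positive degree in X and in Y.

    Let h = alpha f + beta g.  If beta != 0, the bounds on the a_i make h
    head-dominated like g, and Res(h, f) = beta^n Res(g, f) is irreducible up to
    a scalar.  If h = u v, multiplicativity of the resultant
    (resultantMl) makes Res(u, f) or Res(v, f) constant, so u or v is a unit.
    If beta = 0, then h = alpha f is tail-dominated and the same argument
    applies to Res(h, g) = alpha^n Res(f, g).

    Multiplicativity comes from the identity
      Res(q, p) = lead_coef(p)^(deg q) * det(multiplication by q modulo p)
    over a field (resultant_modmul), used here over K(X). *)

Set Implicit Arguments.
Unset Strict Implicit.
Unset Printing Implicit Defensive.

Import GRing.Theory.
Local Open Scope ring_scope.

(** * Swapping the arguments of a resultant *)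

Lemma det_reindex_rows (R : comNzRingType) (m n : nat) (eq_mn : m = n)
    (A : 'M[R]_m) (B : 'M[R]_n) (s : 'I_m -> 'I_n) :
  injective s -> (forall i j, A i j = B (s i) (cast_ord eq_mn j)) ->
  exists e : bool, \det A = (-1) ^+ e * \det B.
Proof.
case: n / eq_mn B s => B s s_inj defA; exists (odd_perm (perm s_inj)).
rewrite -det_perm -det_mulmx -row_permE; congr (\det _).
by apply/matrixP=> i j; rewrite defA cast_ord_id !mxE permE.
Qed.

(** The two Sylvester matrices differ by exchanging the two blocks of rows, and
    the reindexing absorbs the two ways of writing the dimension.  The sign is
    left unspecified: only irreducibility and sizes are tracked below. *)
Lemma resultantC_sign (R : comNzRingType) (p q : {poly R}) :
  exists e : bool, resultant p q = (-1) ^+ e * resultant q p.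
Proof.
pose s i := match split (i : 'I_((size q).-1 + (size p).-1)) with
  | inl k => rshift (size p).-1 k | inr k => lshift (size q).-1 k end.
apply: (@det_reindex_rows R _ _ (addnC _ _) _ _ s) => [i1 i2|i j].
  rewrite /s => eq_s; apply/val_inj; move: eq_s => /=.
  case: (splitP i1) => k1 ->; case: (splitP i2) => k2 -> /eqP.
  - by rewrite (inj_eq (@rshift_inj _ _)) => /eqP->.
  - by rewrite eq_rlshift.
  - by rewrite eq_lrshift.
  - by rewrite (inj_eq (@lshift_inj _ _)) => /eqP->.
rewrite !Sylvester_mxE /s; case: splitP => k _.
  by rewrite -[rshift _ k]/(unsplit (inr k)) unsplitK.
by rewrite -[lshift _ k]/(unsplit (inl k)) unsplitK.
Qed.

(** * The resultant as the determinant of a multiplication map *)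

Section ModularMultiplication.

Variables (F : fieldType) (p : {poly F}).

Local Notation band r := (lin1_mx (poly_rV \o r \o* rVpoly)).

(** Row i holds the coefficients of 'X^i * q reduced modulo p, so that row
    vectors stand for polynomials of degree less than deg p. *)
Definition modmul_mx q : 'M[F]_((size p).-1) :=
  \matrix_i poly_rV ((rVpoly (delta_mx 0 i) * q) %% p).

Hypothesis p_neq0 : p != 0.

Lemma mul_modmul_mx (v : 'rV_((size p).-1)) q :
  v *m modmul_mx q = poly_rV ((rVpoly v * q) %% p).
Proof.
rewrite mulmx_sum_row {2}[v]row_sum_delta linear_sum /= mulr_suml.
rewrite (big_morph _ (modpD p) (mod0p p)) linear_sum /=; apply: eq_bigr => i _.
by rewrite rowK [rVpoly (_ *: _)]linearZ /= -scalerAl modpZl [RHS]linearZ.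
Qed.

Lemma size_modp_pred (q : {poly F}) : (size (q %% p)%R <= (size p).-1)%N.
Proof. by rewrite -ltnS prednK ?ltn_modp // size_poly_gt0. Qed.

Lemma modmul_mxM q r : modmul_mx (q * r) = modmul_mx q *m modmul_mx r.
Proof.
apply/row_matrixP=> i; rewrite [RHS]row_mul !rowK mul_modmul_mx.
rewrite poly_rV_K ?size_modp_pred // [_ %% p * r]mulrC modp_mul.
by rewrite [r * _]mulrC mulrA.
Qed.

Lemma modmul_mx_modZ (a : {poly F}) c q :
  modmul_mx (a * p + c *: q) = c *: modmul_mx q.
Proof.
apply/row_matrixP=> i; rewrite linearZ /= !rowK mulrDr mulrA modpD modp_mull.
by rewrite add0r -scalerAr modpZl linearZ.
Qed.

(** Dividing each row 'X^i * q of the Sylvester matrix by p is a row operation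
    that uses the rows 'X^k * p only.  What is left is the multiplication matrix
    on top, padded by J to the full width, above a triangular band of shifts
    of p with the leading coefficient of p on the diagonal.  Having q as the
    first argument puts that band last, so that no sign appears. *)
Lemma resultant_modmul q :
  resultant q p = lead_coef p ^+ (size q).-1 * \det (modmul_mx q).
Proof.
pose s := (size p).-1; pose t := (size q).-1.
pose J : 'M[F]_(s, s + t) := lin1_mx (poly_rV \o rVpoly).
pose B : 'M[F]_(t, s + t) := band p.
pose D : 'M[F]_(s, t) := \matrix_i poly_rV ((rVpoly (delta_mx 0 i) * q) %/ p).
have defS : Sylvester_mx q p =
    block_mx 1%:M D 0 1%:M *m block_mx (modmul_mx q) 0 0 1%:M *m col_mx J B.
  rewrite mulmx_block !mul0mx !mul1mx !mulmx0 !mulmx1 !add0r !addr0.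
  rewrite mul_block_col mul0mx mul1mx add0r /Sylvester_mx; congr col_mx.
  apply/row_matrixP=> i; rewrite linearD /= !row_mul !rowK !mul_rV_lin1 /=.
  rewrite rowE mul_rV_lin1 /=; set v := rVpoly _.
  rewrite !poly_rV_K ?size_modp_pred //; last first.
    (* The quotient fits in t coefficients because v has at most s of them. *)
    rewrite size_divp // leq_subLR (leq_trans (size_polyMleq _ _)) //.
    have : (size v <= s)%N by exact: size_poly.
    by rewrite /t; case: (size q) => [|k]; rewrite ?addn0 ?addnS /= => lev;
      rewrite ?leq_add2r // (leq_trans (leq_pred _)).
  by rewrite -linearD /= mulrC [in RHS]addrC -divp_eq mulrC.
rewrite /resultant defS !det_mulmx det_ublock det_lblock !det1 !mul1r mulr1.
rewrite mulrC; congr (_ * _).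
have JBE i j : col_mx J B i j = match split i with
    inl k => (k == j :> nat)%:R | inr k => p`_(j - k) *+ (k <= j) end.
  rewrite mxE; case: splitP => k _; rewrite !mxE /= rVpoly_delta.
    by rewrite coefXn eq_sym.
  by rewrite coefXnM ltnNge if_neg -mulrb.
rewrite det_trig; last first.
  apply/is_trig_mxP=> i j lt_ij; rewrite JBE; move: lt_ij.
  case: splitP => k -> lt_kj; first by rewrite ltn_eqF.
  rewrite nth_default ?mul0rn //.
  by apply: leq_trans (leqSpred _) _; rewrite -/s ltn_subRL addnC.
rewrite big_split_ord /= big1 ?mul1r => [|i _]; last first.
  by rewrite JBE -[lshift _ i]/(unsplit (inl i)) unsplitK eqxx.
rewrite (eq_bigr (fun=> lead_coef p)) ?prodr_const ?card_ord // => i _.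
rewrite JBE -[rshift _ i]/(unsplit (inr i)) unsplitK /=.
by rewrite addnK leq_addl mulr1n.
Qed.

End ModularMultiplication.

(** * Multiplicativity of the resultant over K[X] *)

Section FractionField.

Variable K : idomainType.
Implicit Types p q r : {poly {poly K}}.

Local Notation tofracX := (@tofrac {poly K}).

Let tofrac_inj : injective tofracX.
Proof. by move=> x y /eqP; rewrite tofrac_eq => /eqP. Qed.

Lemma resultant_tofrac q p : q != 0 -> p != 0 ->
  tofracX (resultant q p) = resultant (map_poly tofracX q) (map_poly tofracX p).
Proof.
move=> q0 p0; rewrite (@map_resultant _ _ tofracX) //;
  by rewrite tofrac_eq0 lead_coef_eq0.
Qed.

Let map_tofrac_neq0 p : p != 0 -> map_poly tofracX p != 0.
Proof. by rewrite -!size_poly_eq0 (size_map_inj_poly tofrac_inj). Qed.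

Lemma resultantMl q r p : q != 0 -> r != 0 -> p != 0 ->
  resultant (q * r) p = resultant q p * resultant r p.
Proof.
move=> q0 r0 p0; apply: tofrac_inj.
rewrite rmorphM /= !resultant_tofrac ?mulf_neq0 // rmorphM /=.
rewrite !resultant_modmul ?map_tofrac_neq0 // modmul_mxM ?map_tofrac_neq0 //.
rewrite det_mulmx mulrACA -exprD size_mul ?map_tofrac_neq0 //.
congr (_ ^+ _ * _).
by rewrite -!subn1; move: (map_tofrac_neq0 q0) (map_tofrac_neq0 r0);
  rewrite -!size_poly_gt0 => lt0q lt0r; rewrite addnBA // addnBAC // subn1.
Qed.

(** Multiplication by a * p + c *: q modulo p is c times multiplication by q.
    The equality of sizes is what makes the powers of the leading coefficient
    of p agree. *)
Lemma resultant_modZ a (c : {poly K}) q p : c != 0 -> q != 0 -> p != 0 ->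
    size (a * p + c *: q) = size q ->
  resultant (a * p + c *: q) p = c ^+ (size p).-1 * resultant q p.
Proof.
move=> c0 q0 p0 eqs; apply: tofrac_inj.
have h0 : a * p + c *: q != 0 by rewrite -size_poly_eq0 eqs size_poly_eq0.
rewrite rmorphM rmorphXn /= !resultant_tofrac //.
have sz r : size (map_poly tofracX r) = size r.
  exact: size_map_inj_poly tofrac_inj _ _.
rewrite !resultant_modmul ?map_tofrac_neq0 // (sz q) sz eqs.
rewrite rmorphD rmorphM /= map_polyZ modmul_mx_modZ detZ mulrCA.
by congr (_ ^+ _ * _); rewrite sz.
Qed.

End FractionField.

(** * Top coefficients of determinants *)

Section TopCoefficients.

Variable R : comNzRingType.

Lemma coefM_top (p q : {poly R}) m n :
    (size p <= m.+1)%N -> (size q <= n.+1)%N ->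
  (p * q)`_(m + n) = p`_m * q`_n.
Proof.
move=> szp szq; have lt_m : (m < (m + n).+1)%N by rewrite ltnS leq_addr.
rewrite coefM (bigD1 (Ordinal lt_m)) //= addKn big1 ?addr0 // => i.
rewrite -val_eqE /= neq_ltn => /orP[lt_im|lt_mi].
  by rewrite [q`__]nth_default ?mulr0 // (leq_trans szq) // ltn_subRL ltn_add2r.
by rewrite [p`__]nth_default ?mul0r // (leq_trans szp).
Qed.

Lemma coef_prod_top (I : finType) (E : I -> {poly R}) (d : I -> nat) :
    (forall i, size (E i) <= (d i).+1)%N ->
  (\prod_i E i)`_(\sum_i d i)%N = \prod_i (E i)`_(d i).
Proof.
move=> szE; suff [] : (size (\prod_i E i)%R <= (\sum_i d i).+1)%N /\
  (\prod_i E i)`_(\sum_i d i)%N = \prod_i (E i)`_(d i) by [].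
elim/big_rec3: _ => [|i x m P _ [szP <-]]; first by rewrite size_poly1 coef1.
split; last by rewrite coefM_top.
apply: leq_trans (size_polyMleq _ _) _.
by rewrite -subn1 leq_subLR add1n -addnS -addSn leq_add.
Qed.

(** When row i has degree at most d i, the coefficient of degree equal to the
    sum of the d i is computed from the leading parts of the rows alone. *)
Lemma coef_det_top n (A : 'M[{poly R}]_n) (d : 'I_n -> nat) :
    (forall i j, size (A i j) <= (d i).+1)%N ->
  (\det A)`_(\sum_i d i)%N = \det (\matrix_(i, j) (A i j)`_(d i)).
Proof.
move=> szA; rewrite coef_sum; apply: eq_bigr => s _.
rewrite -(rmorph_sign polyC) coefCM coef_prod_top //.
by congr (_ * _); apply: eq_bigr => i _; rewrite mxE.
Qed.

End TopCoefficients.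

(** * Dominant coefficients and their factors *)

Section Dominance.

Variable K : idomainType.
Implicit Types p q : {poly {poly K}}.

Lemma coef_lead_swapXY p i : (lead_coef (swapXY p))`_i = p`_i`_(sizeY p).-1.
Proof. by rewrite lead_coefE -sizeYE coef_swapXY. Qed.

Lemma size_lead_swapXY p : (size (lead_coef (swapXY p)) <= size p)%N.
Proof.
apply/leq_sizeP=> i le_pi.
by rewrite coef_lead_swapXY [p`_i]nth_default // coef0.
Qed.

(** The leading coefficient of swapXY p is the coefficient in K[Y] of the
    highest power of X in p.  It is constant when the coefficient of Y^0 has an
    X-degree larger than all the others. *)
Definition tail_dominated p := size (lead_coef (swapXY p)) = 1%N.
(** The coefficient of the highest power of X has full degree in Y when no
    coefficient of p exceeds the X-degree of the leading one. *)
Definition head_dominated p := size (lead_coef (swapXY p)) = size p.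

Lemma tail_dominated_neq0 p : tail_dominated p -> p != 0.
Proof.
rewrite /tail_dominated; apply: contra_eq_neq => ->.
by rewrite rmorph0 lead_coef0 size_poly0.
Qed.

Lemma size_lead_swapXYM p q : p != 0 -> q != 0 ->
  size (lead_coef (swapXY (p * q))) =
    (size (lead_coef (swapXY p)) + size (lead_coef (swapXY q))).-1.
Proof.
by move=> p0 q0; rewrite rmorphM lead_coefM size_mul ?lead_coef_eq0 ?swapXY_eq0.
Qed.

Lemma size_lead_swapXY_gt0 p :
  p != 0 -> (0 < size (lead_coef (swapXY p)))%N.
Proof. by rewrite size_poly_gt0 lead_coef_eq0 swapXY_eq0. Qed.

Lemma tail_dominated_factor p q : tail_dominated (p * q) -> tail_dominated p.
Proof.
move=> pq_t; have := tail_dominated_neq0 pq_t; rewrite mulf_eq0 => /norP[p0 q0].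
move: pq_t; rewrite /tail_dominated size_lead_swapXYM //.
move: (size_lead_swapXY_gt0 p0) (size_lead_swapXY_gt0 q0).
case: (size _) => // m _; case: (size _) => // k _.
by rewrite addnS addSn /= => -[]; case: m.
Qed.

(** The Y-degrees of u and of its top X-coefficient both add up over a product,
    and the latter never exceeds the former, so equality holds for each factor
    once it holds for the product. *)
Lemma head_dominated_factor p q :
  p * q != 0 -> head_dominated (p * q) -> head_dominated p.
Proof.
rewrite mulf_eq0 /head_dominated => /norP[p0 q0].
rewrite size_lead_swapXYM // size_mul // => /(congr1 S).
have p1 : (0 < size p)%N by rewrite size_poly_gt0.
have lp := size_lead_swapXY_gt0 p0.
rewrite !prednK ?addn_gt0 ?p1 ?lp // => eq_s; apply/eqP.
rewrite eqn_leq size_lead_swapXY.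
rewrite -(leq_add2r (size (lead_coef (swapXY q)))) eq_s.
by rewrite leq_add2l size_lead_swapXY.
Qed.

Lemma tail_dominatedP p :
    (forall i, (0 < i)%N -> (size (p`_i)%R < size (p`_0)%R)%N) ->
  tail_dominated p /\ sizeY p = size (p`_0)%R.
Proof.
move=> dom; have p0 : (0 < size (p`_0)%R)%N.
  exact: leq_trans (dom 1%N _).
have eqY : sizeY p = size (p`_0)%R.
  apply/eqP; rewrite eqn_leq max_size_coefXY andbT.
  apply/bigmax_leqP=> -[i /= _] _.
  by case: i => // i; apply/ltnW/dom.
split=> //; rewrite /tail_dominated; apply/eqP; rewrite eqn_leq.
apply/andP; split.
  apply/leq_sizeP=> i i_gt0; rewrite coef_lead_swapXY eqY nth_default //.
  by rewrite -ltnS prednK // dom.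
rewrite size_poly_gt0 lead_coef_eq0 -size_poly_eq0 -sizeYE eqY.
by rewrite -lt0n.
Qed.

Lemma head_dominatedP p :
    p != 0 -> (forall i, (size (p`_i)%R <= size (lead_coef p))%N) ->
  head_dominated p /\ sizeY p = size (lead_coef p).
Proof.
move=> p0 dom.
have eqY : sizeY p = size (lead_coef p).
  apply/eqP; rewrite eqn_leq max_size_lead_coefXY andbT; exact/bigmax_leqP.
split=> //; rewrite /head_dominated; apply/eqP.
rewrite eqn_leq size_lead_swapXY /=.
rewrite (polySpred p0); apply: contraNT p0; rewrite -leqNgt.
move/leq_sizeP/(_ _ (leqnn _)).
by rewrite coef_lead_swapXY eqY -!lead_coefE => /eqP; rewrite !lead_coef_eq0.
Qed.

(** The matrix of leading parts of the Sylvester matrix is the Sylvester matrix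
    of the top X-coefficients of p and q, formed with the Y-degrees of p and q.
    The former coefficient is constant and the latter has full degree, so this
    matrix is lower triangular with a nonzero diagonal. *)
Lemma size_resultant_dominated p q :
    q != 0 -> tail_dominated p -> head_dominated q ->
  ((sizeY p).-1 * (size q).-1 + (sizeY q).-1 * (size p).-1
     < size (resultant p q))%N.
Proof.
move=> q0 tp hq; have p0 := tail_dominated_neq0 tp.
pose d := (sizeY p).-1; pose e := (sizeY q).-1.
pose w (i : 'I_((size q).-1 + (size p).-1)) :=
  match split i with inl _ => d | inr _ => e end.
have szY (r : {poly {poly K}}) i (b : bool) :
    r != 0 -> (size (r`_i *+ b)%R <= (sizeY r).-1.+1)%N.
  move=> r0; rewrite prednK ?lt0n ?sizeY_eq0 //.
  by case: b; rewrite ?mulr0n ?size_poly0 // mulr1n max_size_coefXY.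
have sum_w : (\sum_i w i = d * (size q).-1 + e * (size p).-1)%N.
  rewrite big_split_ord /=; congr (_ + _)%N.
    rewrite (eq_bigr (fun=> d)) ?sum_nat_const ?card_ord 1?mulnC // => i _.
    by rewrite /w -[lshift _ i]/(unsplit (inl i)) unsplitK.
  rewrite (eq_bigr (fun=> e)) ?sum_nat_const ?card_ord 1?mulnC // => i _.
  by rewrite /w -[rshift _ i]/(unsplit (inr i)) unsplitK.
rewrite -sum_w ltnNge; apply/negP=> /leq_sizeP/(_ _ (leqnn _)).
rewrite coef_det_top => [|i j]; last first.
  by rewrite Sylvester_mxE /w; case: splitP => k _; exact: szY.
set A := \matrix_(i, j) _.
have AE i j : A i j = match split i with
    inl k => (lead_coef (swapXY p))`_(j - k) *+ (k <= j)
  | inr k => (lead_coef (swapXY q))`_(j - k) *+ (k <= j) end.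
  rewrite mxE Sylvester_mxE /w.
  by case: splitP => k _; rewrite coefMn coef_lead_swapXY.
rewrite det_trig; last first.
  apply/is_trig_mxP=> i j lt_ij; rewrite AE; move: lt_ij.
  case: splitP => k -> lt_kj; rewrite nth_default ?mul0rn // ?tp ?subn_gt0 //.
  by rewrite hq; apply: leq_trans (leqSpred _) _; rewrite ltn_subRL addnC.
move/eqP/prodf_eq0 => [i _]; rewrite AE; case: splitP => k ->.
  rewrite subnn leqnn mulr1n.
  have -> : 0%N = (size (lead_coef (swapXY p))).-1 by rewrite tp.
  by rewrite -lead_coefE !lead_coef_eq0 swapXY_eq0 (negPf p0).
rewrite addnK leq_addl mulr1n -hq.
by rewrite -lead_coefE !lead_coef_eq0 swapXY_eq0 (negPf q0).
Qed.

Lemma dominated_resultant_const p q :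
    q != 0 -> tail_dominated p -> head_dominated q ->
    size (resultant p q) = 1%N ->
  ((sizeY p).-1 * (size q).-1 = 0 /\ (sizeY q).-1 * (size p).-1 = 0)%N.
Proof.
move=> q0 tp hq R1; have := size_resultant_dominated q0 tp hq.
by rewrite R1 ltnS leqn0 addn_eq0 => /andP[/eqP-> /eqP->].
Qed.

End Dominance.

(** * Irreducibility from an irreducible resultant *)

Lemma irreducible_poly_factor (K : fieldType) (P A B : {poly K}) (c : K) :
    c != 0 -> irreducible_poly P -> c *: P = A * B ->
  size A = 1%N \/ size B = 1%N.
Proof.
move=> c0 [P_gt1 irrP] defP; have P0 : P != 0 by rewrite -size_poly_gt0 ltnW.
have := size_scale P c0; rewrite defP => szAB.
have [A1|A1] := eqVneq (size A) 1%N; [by left|right].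
have /eqp_size sAP : A %= P.
  by apply: irrP A1 _; rewrite -(dvdpZr _ _ c0) defP dvdp_mulr.
have : A * B != 0 by rewrite -size_poly_gt0 szAB ltnW.
rewrite mulf_eq0 => /norP[A0 B0]; move: szAB; rewrite size_mul // -sAP.
have: (0 < size B)%N by rewrite size_poly_gt0.
case: (size B) => // k _; rewrite addnS /= => /eqP.
by rewrite -[X in _ == X]addn0 eqn_add2l => /eqP->.
Qed.

Section ResultantCriterion.

Variable K : fieldType.
Implicit Types f h u v : {poly {poly K}}.

(** Units of K[X,Y] are the nonzero constants: one nonzero coefficient in Y,
    which is itself a nonzero constant in X. *)
Lemma unit_of_size h : size h = 1%N -> sizeY h = 1%N -> h \is a GRing.unit.
Proof.
have coef0_neq0 (L : nzRingType) (p : {poly L}) : size p = 1%N -> p`_0 != 0.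
  move=> p1; rewrite -[0%N]/(1%N.-1) -p1 -lead_coefE lead_coef_eq0.
  by rewrite -size_poly_eq0 p1.
move=> h1 hY1; have s0 : size h`_0 = 1%N.
  apply/eqP; rewrite eqn_leq -{1}hY1 max_size_coefXY.
  by rewrite size_poly_gt0 coef0_neq0.
by rewrite poly_unitE h1 eqxx /= poly_unitE s0 eqxx unitfE /= coef0_neq0.
Qed.

(** Reads off the vanishing degrees produced by dominated_resultant_const; m and
    n are the sizes in Y and X of the other argument of the resultant. *)
Lemma unit_of_size_products h m n : h != 0 -> (1 < m)%N -> (1 < n)%N ->
    ((sizeY h).-1 * m.-1 = 0)%N -> (n.-1 * (size h).-1 = 0)%N ->
  h \is a GRing.unit.
Proof.
move=> h0; case: m n => [|[|m]] [|[|n]] //= _ _ /eqP + /eqP.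
rewrite !muln_eq0 !orbF /= => hY h1.
have [sY s1] : (0 < sizeY h)%N /\ (0 < size h)%N.
  by rewrite lt0n sizeY_eq0 size_poly_gt0.
apply: unit_of_size; first by move: s1 h1; case: (size h) => [|[]].
by move: sY hY; case: (sizeY h) => [|[]].
Qed.

(** A factorization h = u v splits an irreducible resultant, so one of the two
    factors has a constant resultant with f.  The last hypothesis is applied to
    v as well, which is a left factor by commutativity. *)
Lemma irreducible_elt_by_resultant f h (R : {poly K}) (c : K) :
    f != 0 -> h != 0 -> (1 < size h)%N -> c != 0 -> irreducible_poly R ->
    resultant h f = c *: R ->
    (forall u v, h = u * v -> size (resultant u f) = 1%N ->
      u \is a GRing.unit) ->
  irreducible_elt h.
Proof.
move=> f0 h0 h1 c0 irrR defR unit_u; split=> //.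
  by rewrite poly_unitE; case: (size h) h1 => [|[]].
move=> u v defh; have : u * v != 0 by rewrite -defh.
rewrite mulf_eq0 => /norP[u0 v0].
have := irreducible_poly_factor (B := resultant v f) c0 irrR.
rewrite -defR defh resultantMl // => /(_ _ erefl)[].
  by move/(unit_u _ _ defh); left.
by rewrite mulrC in defh; move/(unit_u _ _ defh); right.
Qed.

End ResultantCriterion.

Lemma coef_sum_monom (R : nzRingType) (c : nat -> R) n i :
  (\sum_(0 <= k < n.+1) (c k)%:P * 'X^k)`_i = if (i <= n)%N then c i else 0.
Proof.
rewrite big_mkord -ltnS -coef_poly poly_def.
by under [in RHS]eq_bigr do rewrite -mul_polyC.
Qed.

Lemma size_poly_coef_neq0 (R : nzRingType) (p : {poly R}) n :
  p`_n != 0 -> (forall i, (n < i)%N -> p`_i = 0) -> size p = n.+1.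
Proof.
move=> pn p_gt; apply/eqP; rewrite eqn_leq; apply/andP; split.
  exact/leq_sizeP.
by rewrite ltnNge; apply: contra pn => /leq_sizeP->.
Qed.

(* K[X,Y] is {poly {poly K}}: the outer variable is Y, the inner one X.        *)
(* Degrees in X are compared through [size], which is deg + 1 on nonzero       *)
(* polynomials and 0 on the zero polynomial (deg 0 = -oo).                     *)
Theorem theorem7p12 (K : fieldType) (n : nat) (a b : nat -> {poly K})
  (f g : {poly {poly K}}) (j : nat)
  (f_def : f = \sum_(0 <= i < n.+1) (a i)%:P * 'X^i)
  (g_def : g = \sum_(0 <= i < n.+1) (b i)%:P * 'X^i)
  (ab_neq0 : a 0%N * a n * b 0%N * b n != 0)
  (j_range : (1 <= j <= n.-1)%N)
  (aj_const : exists2 c : K, c != 0 & a j = c%:P)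
  (bj_const : exists2 c : K, c != 0 & b j = c%:P)
  (res_irr : irreducible_poly (resultant f g))
  (deg_a0 : (\max_(1 <= i < n.+1) size (a i) < size (a 0%N))%N)
  (deg_bn : (\max_(0 <= i < n) size (b i) <= size (b n))%N)
  (deg_ab : forall i : nat, (i < n)%N -> (size (a i) <= size (b i))%N) :
  forall alpha beta : K,
    alpha *: a j + beta *: b j != 0 ->
    irreducible_elt (alpha%:P *: f + beta%:P *: g).
Proof.
move=> alpha beta ab_j.
move: ab_neq0; rewrite !mulf_eq0 !negb_or => /andP[/andP[/andP[a0 an] b0] bn].
have n_gt0 : (0 < n)%N.
  by case/andP: j_range => /leq_trans H /H; case: (n).
have fE i : f`_i = if (i <= n)%N then a i else 0.
  by rewrite f_def coef_sum_monom.
have gE i : g`_i = if (i <= n)%N then b i else 0.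
  by rewrite g_def coef_sum_monom.
have sf : size f = n.+1.
  apply: size_poly_coef_neq0 => [|i lt_ni]; rewrite fE ?leqnn //.
  by rewrite leqNgt lt_ni.
have sg : size g = n.+1.
  apply: size_poly_coef_neq0 => [|i lt_ni]; rewrite gE ?leqnn //.
  by rewrite leqNgt lt_ni.
have f0 : f != 0 by rewrite -size_poly_eq0 sf.
have g0 : g != 0 by rewrite -size_poly_eq0 sg.
have lt_a0 i : (0 < i <= n)%N -> (size (a i) < size (a 0%N))%N.
  move=> lt_i; apply: leq_ltn_trans deg_a0.
  apply: (leq_bigmax_seq (F := fun i => size (a i))) => //.
  by rewrite mem_index_iota.
have le_bn i : (i < n)%N -> (size (b i) <= size (b n))%N.
  move=> lt_i; apply: leq_trans deg_bn.
  apply: (leq_bigmax_seq (F := fun i => size (b i))) => //.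
  by rewrite mem_index_iota.
have a0_gt1 : (1 < size (a 0%N))%N.
  by apply: leq_trans (lt_a0 n _); rewrite ?n_gt0 ?leqnn // ltnS size_poly_gt0.
have bn_gt_an : (size (a n) < size (b n))%N.
  rewrite (leq_trans (lt_a0 n _)) ?n_gt0 ?leqnn //.
  by rewrite (leq_trans (deg_ab _ _)) // le_bn.
have bn_gt1 : (1 < size (b n))%N.
  by rewrite (leq_trans a0_gt1) // (leq_trans (deg_ab _ _)) // le_bn.
have [tf Yf] : tail_dominated f /\ sizeY f = size (a 0%N).
  have -> : a 0%N = f`_0 by rewrite fE.
  apply: tail_dominatedP => i i_gt0; rewrite !fE /=.
  by case: ifP => le_in; rewrite ?size_poly0 ?lt_a0 ?i_gt0 // ltnW.
(* An opaque h, to keep rewriting from unfolding the combination. *)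
have [h hdef] : {h | h = alpha%:P *: f + beta%:P *: g} by eexists.
have hE i : h`_i = if (i <= n)%N then alpha *: a i + beta *: b i else 0.
  rewrite hdef coefD !coefZ fE gE !mul_polyC.
  by case: ifP => // _; rewrite !scaler0 addr0.
have hgt i : (n < i)%N -> h`_i = 0 by move=> lt_ni; rewrite hE leqNgt lt_ni.
rewrite -hdef.
have [beta0|beta0] := eqVneq beta 0.
  have alpha0 : alpha != 0.
    by apply: contraNneq ab_j => ->; rewrite beta0 !scale0r addr0.
  (* Here h = alpha f: its factors are tail-dominated, and g is the modulus. *)
  have [hg Yg] : head_dominated g /\ sizeY g = size (b n).
    have -> : b n = lead_coef g by rewrite lead_coefE sg gE leqnn.
    apply: head_dominatedP => // i; rewrite lead_coefE sg !gE leqnn.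
    case: ifP => [|_]; last by rewrite size_poly0.
    by rewrite leq_eqVlt => /predU1P[->//|/le_bn].
  have hf : h = 0 * g + alpha%:P *: f.
    by rewrite hdef beta0 scale0r mul0r addr0 add0r.
  have sh : size h = n.+1.
    apply: size_poly_coef_neq0 hgt; rewrite hE leqnn beta0 scale0r addr0.
    by rewrite scaler_eq0 negb_or alpha0.
  have h0 : h != 0 by rewrite -size_poly_eq0 sh.
  have th : tail_dominated h.
    have [] // := @tail_dominatedP _ h; move=> i i_gt0.
    rewrite !hE beta0 /= !scale0r !addr0 [X in (_ < X)%N]size_scale //.
    case: ifP => le_in; last by rewrite size_poly0 ltnW.
    by rewrite size_scale ?lt_a0 ?i_gt0.
  apply: (@irreducible_elt_by_resultant _ g h (resultant f g)
    (alpha ^+ n)) => //.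
  - by rewrite sh.
  - by rewrite expf_neq0.
  - rewrite hf resultant_modZ // ?polyC_eq0 // -?hf ?sh //.
    by rewrite sg /= -rmorphXn mul_polyC.
  move=> u v defh R1; have tu : tail_dominated u.
    by apply: (@tail_dominated_factor _ u v); rewrite -defh.
  have [d0 e0] := dominated_resultant_const g0 tu hg R1.
  apply: unit_of_size_products d0 e0; rewrite ?Yg ?sg //.
  exact: tail_dominated_neq0.
(* From here on beta != 0: the leading term of h comes from g, since a_n is
   smaller than b_n, so the factors of h are head-dominated and f is the
   modulus. *)
have szh_n : size (h`_n) = size (b n).
  rewrite hE leqnn addrC size_polyDl !(size_scale _ beta0) //.
  exact: leq_ltn_trans (size_scale_leq _ _) bn_gt_an.
have sh : size h = n.+1.
  by apply: size_poly_coef_neq0 hgt; rewrite -size_poly_eq0 szh_n size_poly_eq0.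
have h0 : h != 0 by rewrite -size_poly_eq0 sh.
have [hh Yh] : head_dominated h /\ sizeY h = size (b n).
  rewrite -szh_n; have -> : h`_n = lead_coef h by rewrite lead_coefE sh.
  apply: head_dominatedP => // i; rewrite lead_coefE sh szh_n.
  have [lt_in|lt_ni|->] := ltngtP i n; last by rewrite szh_n.
    rewrite hE (ltnW lt_in) (leq_trans (size_polyD _ _)) // geq_max.
    rewrite !(leq_trans (size_scale_leq _ _)) ?le_bn //.
    by rewrite (leq_trans (deg_ab _ _)) ?le_bn.
  by rewrite hgt // size_poly0.
have hf : h = (alpha%:P)%:P * f + beta%:P *: g by rewrite hdef mul_polyC.
have [e resC] := resultantC_sign g f.
apply: (@irreducible_elt_by_resultant _ f h (resultant f g)
  (beta ^+ n * (-1) ^+ e)) => //.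
- by rewrite sh.
- by rewrite mulf_neq0 ?signr_eq0 ?expf_neq0.
- rewrite hf resultant_modZ // ?polyC_eq0 // -?hf ?sh //.
  by rewrite sf /= resC -rmorphXn -(rmorph_sign polyC) mulrA -polyCM mul_polyC.
move=> u v defh R1; have hu : head_dominated u.
  by apply: (@head_dominated_factor _ u v); rewrite -defh.
have u0 : u != 0 by apply: contraNneq h0 => u0; rewrite defh u0 mul0r.
have [e' resC'] := resultantC_sign u f.
have R1' : size (resultant f u) = 1%N.
  by rewrite -R1 resC' -(rmorph_sign polyC) mul_polyC size_scale ?signr_eq0.
have [d0 e0] := dominated_resultant_const u0 tf hu R1'.
by apply: (unit_of_size_products u0 _ _ e0 d0); rewrite ?Yf ?sf.
Qed.
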